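(* Let $G$ be a semitopological group with neutral element $e$, and let $m\geq 2$ be an integer. Put $$S_{G}^{m}=\{(x_{1},\ldots,x_{m})\in G^{m}: x_{1}\cdots x_{m}=e\},\qquad E_{G}^{m}=\bigcap_{U\in\mathcal{N}_{e}}\overline{(U^{-1})^{m-1}},$$ and let $\mathfrak{m}:G^{m}\to G$, $\mathfrak{m}(x_1,\ldots,x_m)=x_1\cdots x_m$. Then: (1) $\overline{\{e\}}\subset E_{G}^{m}=\bigcap_{U\in\mathcal{N}_{e}}(U^{-1})^{m}$; (2) $G$ is an $m$-semitopological group if and only if $E_{G}^{m}=\overline{\{e\}}$; (3) $\overline{S_{G}^{m}}=\mathfrak{m}^{-1}(E_{G}^{m})$, where the closure is taken in the product space $G^m$; (4) the following statements are equivalent: (i) $G$ is a $T_{1}$ $m$-semitopological group; (ii) $E_{G}^{m}=\{e\}$; (iii) $S_{G}^{m}$ is closed in $G^{m}$.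
   Context: A semitopological group is a group with a topology making multiplication separately continuous. $\mathcal{N}_e$ is the family of all neighborhoods of $e$ in $G$. For $A\subset G$ and $k\in\mathbb{N}$, $A^{k}=\{a_1\cdots a_k: a_i\in A\}$ and $A^{-1}=\{a^{-1}:a\in A\}$. For $n\in\mathbb{N}$, a semitopological group $G$ is an $n$-semitopological group if for every $g\in G$ with $e\notin\overline{\{g\}}$ there is a neighborhood $W$ of $e$ with $g\notin W^{n}$. (In $G^m$ as a topological space or as the set of $m$-tuples, $G^m$ denotes the Cartesian power with the product topology.) *)

(* Defs.v *)
From HB Require Import structures.
From mathcomp Require Import all_boot all_classical topology.

Set Implicit Arguments.
Unset Strict Implicit.
Unset Printing Implicit Defensive.

Local Open Scope classical_set_scope.
Local Open Scope group_scope.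

HB.mixin Record hasSeparatelyContinuousMul G of Group G & Topological G := {
  mulgl_continuous : forall a : G, continuous (fun x : G => a * x);
  mulgr_continuous : forall a : G, continuous (fun x : G => x * a)
}.

#[short(type="semitopologicalGroupType")]
HB.structure Definition SemitopologicalGroup :=
  {G of Group G & Topological G & hasSeparatelyContinuousMul G}.

Section SemitopologicalGroups.
Context {G : semitopologicalGroupType}.

(* The factors multiply in increasing order of index. *)
Definition mprod (m : nat) (x : 'I_m -> G) : G := \prod_(i < m) x i.

Definition setpow (A : set G) (k : nat) : set G :=
  [set mprod a | a in [set a : 'I_k -> G | forall i, A (a i)]].

Definition setinv (A : set G) : set G := [set a^-1 | a in A].

(* [{ptws 'I_m -> G}] is the function type with the product topology. *)
Definition SG (m : nat) : set {ptws 'I_m -> G} := [set x | mprod x = 1].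

Definition EG (m : nat) : set G :=
  \bigcap_(U in nbhs (1 : G)) closure (setpow (setinv U) m.-1).

End SemitopologicalGroups.

Arguments SG G m : clear implicits.
Arguments EG G m : clear implicits.

Definition n_semitopological (n : nat) (G : semitopologicalGroupType) : Prop :=
  forall g : G, ~ closure [set g] 1 ->
    exists W : set G, nbhs (1 : G) W /\ ~ setpow W n g.

(* Main.v *)
(* The closure of a set A is the intersection of the sets A U^-1 over the
   neighborhoods U of 1, which turns E into the intersection of the (U^-1)^m.
   For (3), put p_i = x_1 ... x_i and write a point near x as
   y_i = p_(i-1)^-1 w_i p_i. Separate continuity makes "y near x" equivalent to
   "all w_i near 1", and the product of the y_i telescopes to
   (w_1 ... w_m)(x_1 ... x_m). Hence x is adherent to S exactly when
   (x_1 ... x_m)^-1 lies in W^m for every neighborhood W of 1. *)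
Require Import Defs.
From mathcomp Require Import all_boot all_classical topology.

Local Open Scope classical_set_scope.
Local Open Scope group_scope.

(** The product topology is the supremum of the initial topologies along the projections, so
    convergence may be tested coordinate by coordinate. *)
Lemma cvg_ptws (I : Type) (T : topologicalType) (F : set_system (I -> T))
    (f : I -> T) : Filter F ->
  (forall i A, nbhs (f i) A -> F [set g | A (g i)]) -> {ptws, F --> f}.
Proof.
move=> FF Ff; apply/cvg_sup => i B [_ [[A oA <-] Afi] AB].
by apply: filterS AB _; apply: Ff; apply: open_nbhs_nbhs.
Qed.

Section SemitopologicalGroupTheory.
Context {G : semitopologicalGroupType}.
Implicit Types (A U W : set G) (x g : G).

Lemma nbhs1_mull x A : nbhs x A -> nbhs 1 [set u | A (x * u)].
Proof. by move=> xA; apply: (mulgl_continuous x 1); rewrite /= mulg1. Qed.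

Lemma nbhs_mull x U : nbhs 1 U -> nbhs x [set y | U (x^-1 * y)].
Proof. by move=> U1; apply: (mulgl_continuous x^-1 x); rewrite /= mulVg. Qed.

Lemma continuous_mul2 (a b : G) : continuous (fun w : G => a * w * b).
Proof.
by move=> w; apply: (continuous_comp (mulgl_continuous a w) (mulgr_continuous b _)).
Qed.

(** Left translations are homeomorphisms, so the sets [x U] form a base at [x]. *)
Lemma closure_mulP A x :
  closure A x <-> forall U, nbhs 1 U -> exists2 a, A a & U (x^-1 * a).
Proof.
split=> [clAx U U1 | AU B /nbhs1_mull/AU[a Aa Ba]].
  by have [a [Aa Ua]] := clAx _ (nbhs_mull _ _ U1); exists a.
by exists a; split=> //; move: Ba; rewrite /= mulVKg.
Qed.

Lemma setinvP A x : setinv A x <-> A x^-1.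
Proof.
by split=> [[a Aa <-]|Ax]; [rewrite invgK | exists x^-1; rewrite ?invgK].
Qed.

Lemma setpow1 A k : A 1 -> setpow A k 1.
Proof. by move=> A1; exists (fun=> 1) => //; apply: big1. Qed.

Lemma setpowS A B k : A `<=` B -> setpow A k `<=` setpow B k.
Proof. by move=> AB _ [a Aa <-]; exists a => // i; apply/AB/Aa. Qed.

Lemma setpow_recr A k g :
  setpow A k.+1 g <-> exists2 a, setpow A k a & A (a^-1 * g).
Proof.
split=> [[a Aa <-]|[_ [b Ab <-] Ag]].
  exists (mprod (fun i => a (widen_ord (leqnSn k) i))).
    by exists (fun i => a (widen_ord (leqnSn k) i)) => // i; apply: Aa.
  by rewrite /mprod big_ord_recr mulKg; apply: Aa.
(* [insub] fails only at the last index [k], where the default supplies the remaining factor. *)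
exists (fun i : 'I_k.+1 => oapp b ((mprod b)^-1 * g) (insub (i : nat))).
  by move=> i /=; case: insub => [j|] //=; apply: Ab.
rewrite /mprod big_ord_recr /= insubF ?ltnn //=.
under eq_bigr => i _ do rewrite valK.
by rewrite mulVKg.
Qed.

Lemma prodVg k (a : 'I_k -> G) :
  (\prod_(i < k) a i)^-1 = \prod_(i < k) (a (rev_ord i))^-1.
Proof.
elim: k => [|k IHk] in a *; first by rewrite !big_ord0 invg1.
rewrite big_ord_recr big_ord_recl invgM IHk; congr (_ * _).
  by congr (a _)^-1; apply: val_inj; rewrite /= subn1.
by apply: eq_bigr => i _; congr (a _)^-1; apply: val_inj; rewrite /= /bump.
Qed.

Lemma setpow_setinv A k g : setpow (setinv A) k g <-> setpow A k g^-1.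
Proof.
split=> [[a Aa <-]|[a Aa ag]].
  exists (fun i => (a (rev_ord i))^-1); first by move=> i; apply/setinvP.
  by rewrite /mprod prodVg.
exists (fun i => (a (rev_ord i))^-1).
  by move=> i; apply/setinvP; rewrite invgK.
by rewrite /mprod -prodVg -[RHS]invgK -ag.
Qed.

Lemma EG_bigcap m : (0 < m)%N ->
  EG G m = \bigcap_(U in nbhs (1 : G)) setpow (setinv U) m.
Proof.
case: m => // m _; apply/seteqP; split=> g gE U U1.
  have /closure_mulP/(_ U U1)[a Aa Ua] := gE _ U1.
  by apply/setpow_recr; exists a => //; apply/setinvP; rewrite invgM invgK.
apply/closure_mulP => V V1.
(* [U] bounds the first [m] factors and [V] tests adherence; the last factor is the inverse of an
   element of [V]. *)
have /setpow_recr[a Aa /setinvP] : setpow (setinv (U `&` V)) m.+1 g.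
  exact/gE/filterI.
rewrite invgM invgK => -[_ Va]; exists a => //.
by apply: setpowS Aa => _ [b [Ub _] <-]; exists b.
Qed.

Lemma EGP m g : (0 < m)%N ->
  EG G m g <-> forall W, nbhs 1 W -> setpow W m g^-1.
Proof.
move=> m0; rewrite EG_bigcap //.
by split=> gE W W1; apply/setpow_setinv; apply: gE.
Qed.

Lemma closure1_sub_EG m : closure [set (1 : G)] `<=` EG G m.
Proof.
move=> g clg U U1; apply: closureS clg => _ ->; apply/setpow1/setinvP.
by rewrite invg1; apply: nbhs_singleton.
Qed.

(** Both sides say that [g^-1] lies in every neighborhood of 1. *)
Lemma closure1V g : closure [set g^-1] 1 <-> closure [set (1 : G)] g.
Proof.
rewrite !closure_mulP.
by split=> gU U /gU[_ ->]; rewrite ?invg1 ?mul1g ?mulg1 => Ug;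
  eexists; rewrite // ?invg1 ?mul1g ?mulg1.
Qed.

(** Contraposed, the definition says that 1 is adherent to {h} whenever h lies in every [W^m]; take
    h = [g^-1]. *)
Lemma n_semitopologicalP m : (0 < m)%N ->
  n_semitopological m G <-> EG G m = closure [set (1 : G)].
Proof.
move=> m0; split=> [nG | EG1 g ncl].
  apply/seteqP; split; last exact: closure1_sub_EG.
  move=> g /EGP-/(_ m0) gW; apply: contrapT => /closure1V/nG[W [W1]].
  by apply; exact: gW.
apply: contrapT => nW; apply: ncl; rewrite -[g]invgK; apply/closure1V.
rewrite -EG1; apply/EGP => // W W1; rewrite invgK.
by apply: contrapT => ngW; apply: nW; exists W.
Qed.

Lemma prod_telescope (p : nat -> G) m (w : 'I_m -> G) :
  \prod_(i < m) ((p i)^-1 * w i * p i.+1) = (p 0)^-1 * (\prod_(i < m) w i) * p m.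
Proof.
elim: m => [|m IHm] in w *; first by rewrite !big_ord0 mulg1 mulVg.
by rewrite !big_ord_recr /= IHm !mulgA mulgK.
Qed.

Lemma partial_prods m (x : 'I_m -> G) :
  exists p : nat -> G, [/\ p 0 = 1, p m = mprod x &
    forall i : 'I_m, p i * x i = p i.+1].
Proof.
(* Extending [x] by 1 lets the partial products be indexed by [nat]. *)
pose x' k := oapp x 1 (insub k); exists (fun k => \prod_(0 <= j < k) x' j).
split=> [||i]; first by rewrite big_geq.
  by rewrite big_mkord; apply: eq_bigr => i _; rewrite /x' valK.
by rewrite big_nat_recr //= {3}/x' valK.
Qed.

Lemma mprod_surj m g : (0 < m)%N -> exists x : 'I_m -> G, mprod x = g.
Proof.
case: m => // m _; exists (fun i => if i == 0%N :> nat then g else 1).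
by rewrite /mprod big_ord_recl big1 ?mulg1.
Qed.

Lemma closure_SG m : (0 < m)%N -> closure (SG G m) = (@mprod G m) @^-1` (EG G m).
Proof.
move=> m0; apply/seteqP; split=> x.
  have [p [p0 pm pS]] := partial_prods m x.
  move=> clx; apply/EGP => // W W1.
  (* Finitely many coordinate conditions, each holding near [x] because
     [p i * x i * (p i.+1)^-1 = 1]. *)
  have xW : nbhs (x : {ptws 'I_m -> G})
      [set y | forall i : 'I_m, W (p i * y i * (p i.+1)^-1)].
    apply: (@filter_forall _ _ (fun (i : 'I_m) (y : {ptws 'I_m -> G}) =>
      W (p i * y i * (p i.+1)^-1)) (nbhs (x : {ptws 'I_m -> G})) _) => i.
    apply: (@proj_continuous _ (fun=> G) i x [set z | W (p i * z * (p i.+1)^-1)]).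
    by apply: continuous_mul2; rewrite /= pS mulgV.
  have [y [/= y1 Wy]] := clx _ xW.
  exists (fun i : 'I_m => p i * y i * (p i.+1)^-1) => //.
  (* Telescoping along the inverses of [p] gives the product [p 0 * 1 * (p m)^-1], the inverse of
     [mprod x]. *)
  have := prod_telescope (fun k => (p k)^-1) m y.
  rewrite p0 pm [X in _ * X * _]y1 invgK !mul1g => <-.
  by apply: eq_bigr => i _; rewrite invgK.
have [p [p0 pm pS]] := partial_prods m x.
move=> /EGP-/(_ m0) xW B xB.
pose y (w : 'I_m -> G) : {ptws 'I_m -> G} :=
  fun i => (p i)^-1 * w i * p i.+1.
(* [F] is generated by the images under [y] of the cubes with side [W]. It converges to [x], since
   [y] sends the constant tuple 1 to [x]. *)
pose F : set_system {ptws 'I_m -> G} := [set P |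
  exists2 W, nbhs 1 W & forall w, (forall i, W (w i)) -> P (y w)].
have FF : Filter F.
  split=> [|P Q [U U1 UP] [V V1 VQ]|P Q PQ [U U1 UP]].
  - by exists setT => //; apply: filterT.
  - exists (U `&` V); first exact: filterI.
    by move=> w UV; split; [apply: UP | apply: VQ] => i; have [] := UV i.
  - by exists U => // w Uw; apply/PQ/UP.
have /(_ B xB)[W W1 WB] : {ptws, F --> x}.
  apply: cvg_ptws => i A xA.
  exists [set w | A ((p i)^-1 * w * p i.+1)]; last by move=> w; apply.
  by apply: continuous_mul2; rewrite /= mulg1 -pS mulKg.
(* The product of [w] is the inverse of [mprod x], so that of [y w] is 1. *)
have [w Ww wx] := xW W W1.
exists (y w); split; last exact: WB.
by rewrite /SG /= /mprod prod_telescope p0 pm invg1 mul1g -/(mprod w) wx mulVg.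
Qed.

Lemma accessible_closure1 :
  accessible_space G <-> closure [set (1 : G)] = [set 1].
Proof.
split=> [/accessible_closed_set1/(_ 1)/closure_id <- // | cl1 x y xy].
(* Translating by [y^-1] would turn adherence of [x] to {y} into adherence of [y^-1 * x] to {1}. *)
exists (~` closure [set y]); split.
- by apply/closed_openC/closed_closure.
- apply/mem_set => /closure_mulP clx; case/eqP: xy.
  suff : closure [set (1 : G)] (y^-1 * x).
    by rewrite cl1 => /(canRL (mulVKg y)) ->; rewrite mulg1.
  apply/closure_mulP => U /clx[_ -> Uxy].
  by exists 1; rewrite // invgM invgK mulg1.
- by apply/mem_set => -[]; apply: subset_closure.
Qed.

End SemitopologicalGroupTheory.

Theorem theorem2p11 (G : semitopologicalGroupType) (m : nat) (hm : (2 <= m)%N) :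
  [/\ (* (1) *)
      closure [set (1 : G)] `<=` EG G m /\
      EG G m = \bigcap_(U in nbhs (1 : G)) setpow (setinv U) m,
      (* (2) *)
      n_semitopological m G <-> EG G m = closure [set (1 : G)],
      (* (3) *)
      closure (SG G m) = (@mprod G m) @^-1` (EG G m)
    & (* (4) *)
      [<-> accessible_space G /\ n_semitopological m G;
           EG G m = [set (1 : G)];
           closed (SG G m)]].
Proof.
have m0 : (0 < m)%N by apply: ltnW.
have nP := n_semitopologicalP m m0.
split; [by split; [exact: closure1_sub_EG | exact: EG_bigcap] | exact: nP
  | exact: closure_SG |].
tfae=> [[/accessible_closure1 <- /nP] // | EG1 | /closure_id].
  by apply/closure_id; rewrite closure_SG // EG1.
rewrite closure_SG // => SGE.
(* The preimages of [EG G m] and {1} under [mprod] coincide, and [mprod] is surjective. *)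
have EG1 : EG G m `<=` [set 1].
  move=> g Eg; have [x xg] := mprod_surj m g m0.
  have : SG G m x by rewrite SGE /= xg.
  by rewrite /SG /= xg.
have cl1 : closure [set (1 : G)] = [set 1].
  apply/seteqP; split; last exact: subset_closure.
  by apply: subset_trans EG1; apply: closure1_sub_EG.
split; first exact/accessible_closure1.
apply/nP/seteqP; split; last exact: closure1_sub_EG.
by rewrite cl1.
Qed.
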